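(* Let $\alpha>0$, $1\leq p\leq \infty$ and $(a,b)\in \mathbb{R}^2$ with $a<b$. Then $J_a^\alpha$ is a linear and continuous operator from $L^p([a,b];\mathbb{R})$ to $L^p([a,b];\mathbb{R})$. Moreover, $$\left\|J_a^\alpha f\right\|_{L^p([a,b];\mathbb{R})}\leq \|f\|_{L^p([a,b];\mathbb{R})},\quad f\in L^p([a,b];\mathbb{R}).$$
   Context: The exponential-integral function is $E_1(x)=\int_x^\infty \frac{e^{-t}}{t}\,dt$ for $x>0$. For $\alpha>0$, $a<b$ real and $f\in L^1([a,b];\mathbb{R})$, the left-sided fractional integral of first kind of order $\alpha$ of $f$ is $$(J_a^\alpha f)(x)=\frac{1}{\alpha}\int_a^x E_1\left(\frac{x-t}{\alpha}\right)f(t)\,dt\quad\text{for a.e. } x\in[a,b].$$ *)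

(* Defs.v *)
From HB Require Import structures.
From mathcomp Require Import all_boot all_order all_algebra.
From mathcomp Require Import all_classical all_reals all_analysis.
From mathcomp Require Import ess_sup_inf measurable_realfun.

Set Implicit Arguments.
Unset Strict Implicit.
Unset Printing Implicit Defensive.
Import Order.TTheory GRing.Theory Num.Theory.
Import numFieldNormedType.Exports.

Local Open Scope classical_set_scope.
Local Open Scope ring_scope.

(* The library's [LspaceType mu p1] (classes of functions modulo equality
   mu-a.e., with finite p-norm, p possibly +oo) carries no algebraic structure.
   Here it is made a normed module over [R]: operations on representatives, and
   norm the p-norm of any representative (see [LspaceP], [Lspace_addrE],
   [Lspace_scalerE], [Lspace_normrE]). *)
Section Lspace_normed.
Context d (T : measurableType d) (R : realType).
Variables (mu : {measure set T -> \bar R}) (p : \bar R) (p1 : (1 <= p)%E).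
Local Notation Lp := (LspaceType mu p1).
Local Notation Lf := (LfunType mu p1).

Lemma Lnorm_ae (f g : T -> R) : measurable_fun setT f -> measurable_fun setT g ->
  f = g %[ae mu] -> 'N[mu]_p[EFin \o f]%E = 'N[mu]_p[EFin \o g]%E.
Proof.
move=> mf mg fg; rewrite unlock /Lnorm.
case: p p1 => [r r1|_|//].
- have mpow (h : T -> R) : measurable_fun setT h ->
      measurable_fun setT (fun x : T => (`|(EFin \o h) x| `^ r)%E : \bar R).
    move=> mh; rewrite (_ : (fun x => _) = EFin \o (fun x => `|h x| `^ r)) //.
    apply: measurableT_comp => //; apply: (measurableT_comp (measurable_powR _)).
    exact: measurableT_comp.
  congr (_ `^ _)%E; apply: ae_eq_integral => //; [exact: mpow|exact: mpow|].
  by apply: filterS fg => x /(_ I) /= ->.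
- case: ifPn => // _; apply: eq_ess_sup.
  by apply: filterS fg => x /(_ I) /= ->.
Qed.

Lemma LspaceP (u v : Lp) : (u : T -> R) = v %[ae mu] -> u = v.
Proof.
move: u v => [u [[pu]]] [v [[pv]]] /= uv.
have e : u = v by rewrite -[u]reprK -[v]reprK; apply/eqmodP/asboolP.
by subst v; rewrite (Prop_irrelevance pu pv).
Qed.

HB.instance Definition _ := gen_eqMixin Lp.
HB.instance Definition _ := gen_choiceMixin Lp.

Section class.
Variable f : Lf.

(* [LspaceType] is built on functions into [measurableTypeR R], whose display
   differs from that of the codomain [R] of [LfunType]. *)
Definition Lfun_measurableTypeR : T -> measurableTypeR R := f.

Lemma measurable_Lfun_measurableTypeR :
  measurable_fun setT Lfun_measurableTypeR.
Proof. exact: (@measurable_funPT _ _ _ _ (f : {mfun T >-> R})). Qed.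

HB.instance Definition _ := isMeasurableFun.Build _ _ T (measurableTypeR R)
  Lfun_measurableTypeR measurable_Lfun_measurableTypeR.

Definition Lclass_sort : {mfun_ mu, T >-> measurableTypeR R} :=
  \pi_({mfun_ mu, T >-> measurableTypeR R})%qT Lfun_measurableTypeR.

Lemma Lclass_sort_ae : (Lclass_sort : T -> R) = f %[ae mu].
Proof.
have /eqmodP/asboolP : Lclass_sort =
  \pi_({mfun_ mu, T >-> measurableTypeR R})%qT (repr Lclass_sort).
  by rewrite reprK.
exact: ae_eq_sym.
Qed.

Lemma Lclass_finite : finite_norm mu p (Lclass_sort : T -> R).
Proof.
have e : ('N[mu]_p[EFin \o (Lclass_sort : T -> R)] = 'N[mu]_p[EFin \o f])%E.
  apply: Lnorm_ae Lclass_sort_ae; last exact: measurable_funPT.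
  exact: (@measurable_funPT _ _ _ (measurableTypeR R) (repr Lclass_sort)).
by rewrite /finite_norm e; exact: (@Lfunction_finite _ _ _ _ _ p1 f).
Qed.

HB.instance Definition _ :=
  isFinLebesgue.Build d T R mu p p1 Lclass_sort Lclass_finite.

Definition Lclass : Lp := Lclass_sort.

Lemma LclassE : (Lclass : T -> R) = f %[ae mu].
Proof. exact: Lclass_sort_ae. Qed.
End class.

Section repr.
Variable u : Lp.

Lemma Lrepr_in : (u : T -> R) \in Lfun mu p.
Proof.
apply/andP; split; rewrite inE/=; last exact: (@Lebesgue_finite _ _ _ _ _ p1 u).
exact: (@measurable_funPT _ _ _ (measurableTypeR R)
  (repr (u : {mfun_ mu, T >-> measurableTypeR R}))).
Qed.

Definition Lrepr : Lf := Lfun_Sub p1 Lrepr_in.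
End repr.

Definition Lspace_add (u v : Lp) : Lp := Lclass (Lrepr u + Lrepr v).
Definition Lspace_opp (u : Lp) : Lp := Lclass (- Lrepr u).
Definition Lspace_zero : Lp := Lclass 0.
Definition Lspace_scale (a : R) (u : Lp) : Lp := Lclass (a *: Lrepr u).
Definition Lspace_norm (u : Lp) : R := fine ('N[mu]_p[EFin \o (u : T -> R)])%E.

Lemma Lspace_addE (u v : Lp) :
  (Lspace_add u v : T -> R) = (u : T -> R) \+ (v : T -> R) %[ae mu].
Proof. exact: LclassE. Qed.

Lemma Lspace_oppE (u : Lp) :
  (Lspace_opp u : T -> R) = \- (u : T -> R) %[ae mu].
Proof. exact: LclassE. Qed.

Lemma Lspace_zeroE : (Lspace_zero : T -> R) = cst 0 %[ae mu].
Proof. exact: LclassE. Qed.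

Lemma Lspace_scaleE (a : R) (u : Lp) :
  (Lspace_scale a u : T -> R) = a \*: (u : T -> R) %[ae mu].
Proof. exact: LclassE. Qed.

Lemma Lspace_addA : associative Lspace_add.
Proof.
move=> u v w; apply: LspaceP.
apply: filter_app (Lspace_addE u v).
apply: filter_app (Lspace_addE (Lspace_add u v) w).
apply: filter_app (Lspace_addE v w).
apply: filter_app (Lspace_addE u (Lspace_add v w)).
apply: filterE => x e1 e2 e3 e4 _.
by rewrite e1 // e3 //= e2 // e4 //= addrA.
Qed.

Lemma Lspace_addC : commutative Lspace_add.
Proof.
move=> u v; apply: LspaceP.
apply: filter_app (Lspace_addE v u).
apply: filter_app (Lspace_addE u v).
apply: filterE => x e1 e2 _.
by rewrite e1 // e2 //= addrC.
Qed.

Lemma Lspace_add0 : left_id Lspace_zero Lspace_add.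
Proof.
move=> u; apply: LspaceP.
apply: filter_app Lspace_zeroE.
apply: filter_app (Lspace_addE Lspace_zero u).
apply: filterE => x e1 e2 _.
by rewrite e1 //= e2 //= add0r.
Qed.

Lemma Lspace_addN : left_inverse Lspace_zero Lspace_opp Lspace_add.
Proof.
move=> u; apply: LspaceP.
apply: filter_app Lspace_zeroE.
apply: filter_app (Lspace_oppE u).
apply: filter_app (Lspace_addE (Lspace_opp u) u).
apply: filterE => x e1 e2 e3 _.
by rewrite e1 //= e2 // e3 //= addNr.
Qed.

HB.instance Definition _ :=
  GRing.isZmodule.Build Lp Lspace_addA Lspace_addC Lspace_add0 Lspace_addN.

Lemma Lspace_scaleA (a b : R) (u : Lp) :
  Lspace_scale a (Lspace_scale b u) = Lspace_scale (a * b) u.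
Proof.
apply: LspaceP.
apply: filter_app (Lspace_scaleE (a * b) u).
apply: filter_app (Lspace_scaleE b u).
apply: filter_app (Lspace_scaleE a (Lspace_scale b u)).
apply: filterE => x e1 e2 e3 _.
by rewrite e1 //= e2 // e3 //= scalerA.
Qed.

Lemma Lspace_scale1 : left_id 1 Lspace_scale.
Proof.
move=> u; apply: LspaceP.
apply: filter_app (Lspace_scaleE 1 u).
apply: filterE => x e1 _.
by rewrite e1 //= scale1r.
Qed.

Lemma Lspace_scaleDr : right_distributive Lspace_scale +%R.
Proof.
move=> a u v; apply: LspaceP.
apply: filter_app (Lspace_scaleE a v).
apply: filter_app (Lspace_scaleE a u).
apply: filter_app (Lspace_addE (Lspace_scale a u) (Lspace_scale a v)).
apply: filter_app (Lspace_addE u v).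
apply: filter_app (Lspace_scaleE a (u + v)).
apply: filterE => x e1 e2 e3 e4 e5 _.
by rewrite e1 //= e3 //= e2 // e4 // e5 //= scalerDr.
Qed.

Lemma Lspace_scaleDl (u : Lp) :
  {morph Lspace_scale^~ u : a b / a + b >-> a + b}.
Proof.
move=> a b; apply: LspaceP.
apply: filter_app (Lspace_addE (Lspace_scale a u) (Lspace_scale b u)).
apply: filter_app (Lspace_scaleE b u).
apply: filter_app (Lspace_scaleE a u).
apply: filter_app (Lspace_scaleE (a + b) u).
apply: filterE => x e1 e2 e3 e4 _.
by rewrite e1 //= e4 //= e2 // e3 //= scalerDl.
Qed.

HB.instance Definition _ := GRing.Zmodule_isLmodule.Build R Lp
  Lspace_scaleA Lspace_scale1 Lspace_scaleDr Lspace_scaleDl.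

Lemma Lspace_normE (u : Lp) :
  (Lspace_norm u)%:E = 'N[mu]_p[EFin \o (u : T -> R)]%E.
Proof. exact: (finite_norm_fine (Lrepr u)). Qed.

Lemma Lspace_norm_class (f : Lf) : Lspace_norm (Lclass f) =
  fine ('N[mu]_p[EFin \o f])%E.
Proof.
congr fine; apply: Lnorm_ae (LclassE f); last exact: measurable_funPT.
exact: (@measurable_funPT _ _ _ (measurableTypeR R) (repr (Lclass_sort f))).
Qed.

Lemma Lspace_ler_normD (u v : Lp) :
  Lspace_norm (u + v) <= Lspace_norm u + Lspace_norm v.
Proof. rewrite Lspace_norm_class; exact: ler_LnormD. Qed.

Lemma Lspace_normZ (a : R) (u : Lp) :
  Lspace_norm (a *: u) = `|a| * Lspace_norm u.
Proof.
apply: EFin_inj; rewrite Lspace_norm_class finite_norm_fine.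
by rewrite EFinM Lspace_normE (LnormZ (Lrepr u)).
Qed.

Lemma Lspace_norm0_eq0 (u : Lp) : Lspace_norm u = 0 -> u = 0.
Proof.
move=> /(@fine_Lnormr_eq0 _ _ _ mu p p1 (Lrepr u)) u0; apply: LspaceP.
apply: filter_app Lspace_zeroE.
apply: filter_app u0.
apply: filterE => x e1 e2 _; rewrite e2 //; exact: e1.
Qed.

HB.instance Definition _ := Lmodule_isNormed.Build R Lp
  Lspace_ler_normD Lspace_normZ Lspace_norm0_eq0.

Lemma Lspace_normrE (u : Lp) :
  (`|u|)%:E = 'N[mu]_p[EFin \o (u : T -> R)]%E.
Proof. exact: Lspace_normE. Qed.

Lemma Lspace_addrE (u v : Lp) :
  (u + v : T -> R) = (u : T -> R) \+ (v : T -> R) %[ae mu].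
Proof. exact: Lspace_addE. Qed.

Lemma Lspace_scalerE (a : R) (u : Lp) :
  (a *: u : T -> R) = a \*: (u : T -> R) %[ae mu].
Proof. exact: Lspace_scaleE. Qed.

End Lspace_normed.

Section fractional_integral.
Context {R : realType}.

(* Only relevant for 0 < x; elsewhere the integral diverges and this is junk. *)
Definition E1 (x : R) : R :=
  \int[lebesgue_measure]_(t in `[x, +oo[) (expR (- t) / t).

(* Lebesgue measure concentrated on [a, b]: its L^p space is L^p([a, b]), since
   values outside [a, b] are irrelevant modulo a.e. equality. *)
Definition lebesgue_on (a b : R) : {measure set (measurableTypeR R) -> \bar R} :=
  mrestr lebesgue_measure (measurable_itv `[a, b]).

Definition frac_integrand (alpha : R) (f : R -> R) (x t : R) : R :=
  E1 ((x - t) / alpha) * f t.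

(* g is (a version of) J_a^alpha f on [a, b]. Integrability is required
   explicitly because the library's integral is a total function. The value of
   the integrand at t = x, where [E1] is evaluated at 0, is immaterial. *)
Definition is_frac_integral (alpha a b : R) (f g : R -> R) : Prop :=
  \forall x \ae lebesgue_on a b,
    lebesgue_measure.-integrable `[a, x] (EFin \o frac_integrand alpha f x) /\
    g x = alpha^-1 *
      \int[lebesgue_measure]_(t in `[a, x]) frac_integrand alpha f x t.

End fractional_integral.

(* Main.v *)
(* J_a^alpha is the integral operator on [a, b] with kernel
   k(x, t) = E_1((x - t) / alpha) / alpha for t <= x, and 0 for t > x. The
   integral of E_1 over (0, oo) is int (e^-u / u) u du = 1 by Tonelli, so both
   marginals of k are at most 1, and Schur's test gives norm at most 1 on every
   L^p: for finite p, Hoelder's inequality bounds |int k f|^p by int k |f|^p,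
   whose integral in x is at most int |f|^p by Tonelli. *)
From HB Require Import structures.
Require Import Defs.
From mathcomp Require Import all_boot all_order all_algebra.
From mathcomp Require Import all_classical all_reals all_analysis.
From mathcomp Require Import ess_sup_inf measurable_realfun.

Set Implicit Arguments.
Unset Strict Implicit.
Unset Printing Implicit Defensive.
Import Order.TTheory GRing.Theory Num.Theory.
Import numFieldNormedType.Exports.
Local Open Scope classical_set_scope.
Local Open Scope ring_scope.

Lemma le_poweR (R : realType) (r : R) (x y : \bar R) :
  0 <= r -> (0 <= x -> x <= y -> x `^ r <= y `^ r)%E.
Proof.
move=> r0 x0 xy; apply: gt0_ler_poweR; rewrite ?in_itv/= ?leey ?andbT//.
exact: le_trans xy.
Qed.

(** * Schur's test for a nonnegative kernel on a finite measure space *)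

Section schur.
Local Open Scope ereal_scope.
Context d (T : measurableType d) (R : realType).

(** Jensen's inequality for a weight of mass at most 1. It is Hölder's inequality for w^(1/r) g and
    w^(1/q), with [q] conjugate to [r], since their product is w g. *)
Lemma poweR_integral_le (mu : {measure set T -> \bar R}) (w g : T -> R) r :
  (1 <= r)%R -> measurable_fun setT w -> measurable_fun setT g ->
  (forall x, 0 <= w x)%R -> (forall x, 0 <= g x)%R ->
  \int[mu]_x (w x)%:E <= 1 ->
  (\int[mu]_x (w x * g x)%:E) `^ r <= \int[mu]_x (w x * g x `^ r)%:E.
Proof.
move=> r1 mw mg w0 g0 w1.
have r0 : (0 < r)%R by apply: lt_le_trans r1.
have int_ge0 (h : T -> R) : (forall x, 0 <= h x)%R -> 0 <= \int[mu]_x (h x)%:E.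
  by move=> h0; apply: integral_ge0 => x _; rewrite lee_fin.
have mpow (h : T -> R) s : measurable_fun setT h ->
    measurable_fun setT (fun x => h x `^ s)%R.
  exact: (measurableT_comp (measurable_powR _)).
(* The exponent conjugate to 1 would be infinite, so [r = 1] is treated apart; there both sides
   coincide. *)
have [->|rn1] := eqVneq r 1%R.
  rewrite poweRe1; last by apply: int_ge0 => x; exact: mulr_ge0.
  by under [leRHS]eq_integral do rewrite powRr1//.
pose q := (1 - r^-1)^-1%R.
have qV : (0 < 1 - r^-1)%R.
  by rewrite subr_gt0 invf_lt1// lt_neqAle eq_sym rn1.
have q0 : (0 < q)%R by rewrite invr_gt0.
have rq : (r^-1 + q^-1 = 1)%R by rewrite /q invrK subrKC.
pose W x := (w x `^ r^-1 * g x)%R; pose V x := (w x `^ q^-1)%R.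
have W0 x : (0 <= W x)%R by rewrite mulr_ge0// powR_ge0.
have V0 x : (0 <= V x)%R by rewrite powR_ge0.
have mW : measurable_fun setT W by apply: measurable_funM => //; exact: mpow.
have mV : measurable_fun setT V by exact: mpow.
have WV x : (W x * V x = w x * g x)%R.
  rewrite /W /V mulrAC -powRD rq ?powRr1//.
  by rewrite oner_eq0.
have := hoelder mu mW mV r0 q0 rq.
rewrite Lnorm1.
under eq_integral do rewrite /= WV ger0_norm ?mulr_ge0//.
rewrite unlock /Lnorm.
under [X in X `^ r^-1]eq_integral => x _.
  rewrite /= ger0_norm// /W powRM ?powR_ge0// -powRrM mulVf ?gt_eqF// powRr1//.
  over.
under [X in X `^ q^-1]eq_integral => x _.
  rewrite /= ger0_norm// /V -powRrM mulVf ?gt_eqF// powRr1//.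
  over.
move=> H.
have I0 : 0 <= \int[mu]_x (w x * g x `^ r)%:E.
  by apply: int_ge0 => x; rewrite mulr_ge0// powR_ge0.
have {}H : \int[mu]_x (w x * g x)%:E <=
    (\int[mu]_x (w x * g x `^ r)%:E) `^ r^-1.
  (* The second Hölder factor is the mass of [w] to the power 1/q, hence at most 1. *)
  apply: (le_trans H); rewrite -[leRHS]mule1; apply: lee_wpmul2l.
    exact: poweR_ge0.
  rewrite -[leRHS](poweR1r q^-1).
  by apply: le_poweR => //; [rewrite invr_ge0 ltW|exact: int_ge0].
apply: (@le_trans _ _ (((\int[mu]_x (w x * g x `^ r)%:E) `^ r^-1) `^ r)).
  apply: le_poweR => //; first exact: ltW.
  by apply: int_ge0 => x; exact: mulr_ge0.
by rewrite -poweRrM mulVf ?gt_eqF// poweRe1.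
Qed.

Variables (mu : {finite_measure set T -> \bar R}) (k : T * T -> R).
Hypotheses (mk : measurable_fun setT k) (k0 : forall z, (0 <= k z)%R).
Hypotheses (k1 : forall x, \int[mu]_y (k (x, y))%:E <= 1)
           (k2 : forall y, \int[mu]_x (k (x, y))%:E <= 1).

Definition kernel_op (f : T -> R) (x : T) : R :=
  Rintegral mu setT (fun y => k (x, y) * f y)%R.

Let mk1 x : measurable_fun setT (fun y => k (x, y)).
Proof. exact: measurableT_comp. Qed.

Let mkf (f : T -> R) : measurable_fun setT f ->
  measurable_fun setT (fun z : T * T => k z * f z.2)%R.
Proof. by move=> mf; apply: measurable_funM => //; exact: measurableT_comp. Qed.

Let mkfx (f : T -> R) x : measurable_fun setT f ->
  measurable_fun setT (fun y => k (x, y) * f y)%R.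
Proof. by move=> mf; apply: measurable_funM. Qed.

(** Tonelli lets [x] be integrated first, and [k2] bounds that inner integral by 1. This is the L^1
    estimate; it is later applied to |f| and to |f|^r. *)
Lemma integral_kernel_le (f : T -> R) : measurable_fun setT f ->
  (forall x, 0 <= f x)%R ->
  \int[mu]_x \int[mu]_y (k (x, y) * f y)%:E <= \int[mu]_y (f y)%:E.
Proof.
move=> mf f0.
rewrite (fubini_tonelli (fun z => (k z * f z.2)%:E))/=; last 2 first.
  by apply/measurable_EFinP; exact: mkf.
  by move=> z; apply: mulr_ge0.
have mk2 y : measurable_fun setT (fun x => (k (x, y))%:E).
  by apply/measurable_EFinP; exact: measurableT_comp.
have E y : \int[mu]_x (k (x, y) * f y)%:E = (f y)%:E * \int[mu]_x (k (x, y))%:E.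
  under eq_integral do rewrite mulrC EFinM.
  by rewrite ge0_integralZl// ?lee_fin// => z _; rewrite lee_fin.
under eq_integral do rewrite E.
apply: ge0_le_integral => //.
- move=> y _; rewrite mule_ge0 ?lee_fin//; apply: integral_ge0 => x _.
  by rewrite lee_fin.
- apply: emeasurable_funM; first exact/measurable_EFinP.
  apply: (measurable_fun_fubini_tonelli_G (fun z => (k z)%:E)).
    exact/measurable_EFinP.
  by move=> z; rewrite lee_fin.
- exact/measurable_EFinP.
- by move=> y _; rewrite -[leRHS]mule1 lee_wpmul2l ?lee_fin.
Qed.

Section integrable.
Variable f : T -> R.
Hypothesis fi : mu.-integrable setT (EFin \o f).

Let mf : measurable_fun setT f.
Proof. exact/measurable_EFinP/(measurable_int mu fi). Qed.

(** The L^1 estimate for |f| gives integrability on the product space. Fubini then yields both the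
    integrability of almost every section and the measurability of [kernel_op f]. *)
Lemma integrable_kernel :
  (mu \x mu)%E.-integrable setT (fun z : T * T => (k z * f z.2)%:E).
Proof.
apply/integrable12ltyP; first by apply/measurable_EFinP; exact: mkf.
under eq_integral do under eq_integral do
  rewrite abse_EFin normrM (ger0_norm (k0 _)).
apply: le_lt_trans.
  apply: (@integral_kernel_le (fun y => `|f y|%R)) => //.
  exact: measurableT_comp.
by move/integrableP : fi => [].
Qed.

Lemma ae_integrable_kernel :
  \forall x \ae mu, mu.-integrable setT (fun y => (k (x, y) * f y)%:E).
Proof. exact: ae_integrable1 integrable_kernel. Qed.

Lemma measurable_kernel_op : measurable_fun setT (kernel_op f).
Proof.
apply: measurableT_comp => //.
exact: measurable_fubini_F integrable_kernel.
Qed.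

Lemma kernel_op_norm x : mu.-integrable setT (fun y => (k (x, y) * f y)%:E) ->
  `|kernel_op f x|%:E <= \int[mu]_y (k (x, y) * `|f y|)%:E.
Proof.
move=> kfi; rewrite -abse_EFin /kernel_op /Rintegral fineK; last first.
  exact: integrable_fin_num.
apply: le_trans (le_abse_integral _ _ _) _ => //.
  exact: measurable_int kfi.
by under eq_integral do rewrite abse_EFin normrM (ger0_norm (k0 _)).
Qed.

Lemma Lnorm_kernel_op p : 1 <= p ->
  'N[mu]_p[EFin \o kernel_op f] <= 'N[mu]_p[EFin \o f].
Proof.
have mpow (h : T -> R) s : measurable_fun setT h ->
    measurable_fun setT (fun x => `|h x| `^ s)%R.
  move=> mh; apply: (measurableT_comp (measurable_powR _)).
  exact: measurableT_comp.
rewrite unlock /Lnorm; case: p => [r r1|_|//].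
- rewrite lee_fin in r1.
  have r0 : (0 < r)%R by apply: lt_le_trans r1.
  apply: le_poweR; first by rewrite invr_ge0 ltW.
  + by apply: integral_ge0 => x _; exact: poweR_ge0.
  (* The L^1 estimate for |f|^r reduces the claim to bounding |kernel_op f x|^r, for almost every
     [x], by the integral of k(x, y) |f y|^r in [y]. *)
  apply: le_trans (@integral_kernel_le (fun y => `|f y| `^ r)%R _ _);
    last 2 first.
  + exact: mpow.
  + by move=> x; exact: powR_ge0.
  apply: ae_ge0_le_integral => //.
  + by move=> x _; exact: poweR_ge0.
  + have : measurable_fun setT (fun x => (`|kernel_op f x| `^ r)%:E)%R.
      by apply/measurable_EFinP; apply: mpow; exact: measurable_kernel_op.
    exact.
  + move=> x _; apply: integral_ge0 => y _.
    by rewrite lee_fin mulr_ge0// powR_ge0.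
  + apply: (measurable_fun_fubini_tonelli_F
      (fun z : T * T => (k z * (fun y => `|f y| `^ r) z.2)%:E)%R).
      apply/measurable_EFinP; apply: (mkf (f := fun y => `|f y| `^ r)%R).
      exact: mpow.
    by move=> z; apply: mulr_ge0 => //; exact: powR_ge0.
  apply: filterS ae_integrable_kernel => x kfi _ /=.
  (* Jensen's inequality with weight [k (x, .)], whose mass is at most 1 by [k1]. *)
  apply: le_trans (poweR_integral_le r1 (mk1 x) _ _ _ (k1 x)) => //.
    rewrite -poweR_EFin; apply: le_poweR => //; first exact: ltW.
    exact: kernel_op_norm.
  exact: measurableT_comp.
- case: ifPn => // mu0; apply/ess_supP.
  have fle := ess_sup_ge mu (abse \o (EFin \o f)).
  apply: filterS ae_integrable_kernel => x kfi.
  apply: le_trans (kernel_op_norm kfi) _.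
  set M := ess_sup _ _ in fle *.
  (* The positive total mass [mu0] matters here: over a null space the essential supremum is
     [-oo]. *)
  have M0 : 0 <= M by apply: ess_sup_gee => //; apply/nearW => y /=.
  apply: (@le_trans _ _ (\int[mu]_y (M * (k (x, y))%:E))).
    apply: ae_ge0_le_integral => //.
    + by move=> y _; rewrite lee_fin mulr_ge0.
    + apply/measurable_EFinP; apply: measurable_funM => //.
      exact: measurableT_comp.
    + by move=> y _; rewrite mule_ge0// lee_fin.
    + apply: emeasurable_funM => //; exact/measurable_EFinP.
    apply: filterS fle => y fy _; rewrite mulrC EFinM.
    by rewrite lee_wpmul2r ?lee_fin.
  rewrite ge0_integralZl//; first by rewrite -[leRHS]mule1 lee_wpmul2l.
    exact/measurable_EFinP.
  by move=> y _; rewrite lee_fin.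
Qed.
End integrable.

Section Lspace_operator.
Variables (p : \bar R) (p1 : 1 <= p).
Local Notation Lp := (LspaceType mu p1).

(** On a finite measure space L^p is contained in L^1, so the results for integrable [f] apply to
    every class. *)
Let integrable_Lspace (u : Lp) : mu.-integrable setT (EFin \o (u : T -> R)).
Proof.
apply/Lfun1_integrable; apply: Lfun_subset (Lrepr_in u) => //.
exact: fin_num_measure.
Qed.

Let measurable_Lspace (u : Lp) : measurable_fun setT (u : T -> R).
Proof. exact/measurable_EFinP/(measurable_int mu (integrable_Lspace u)). Qed.

(** Integration in [y] ignores null sets, so the two functions agree at every [x], not just almost
    everywhere. Hence the choice of representative of a class is immaterial. *)
Lemma kernel_op_ae (f g : T -> R) : measurable_fun setT f ->
  measurable_fun setT g -> f = g %[ae mu] -> kernel_op f = kernel_op g.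
Proof.
move=> mf mg fg; apply/funext => x; congr fine; apply: ae_eq_integral => //.
- by apply/measurable_EFinP; exact: mkfx.
- by apply/measurable_EFinP; exact: mkfx.
- by apply: filterS fg => y /= /[apply] ->.
Qed.

Lemma kernel_op_Lfun (u : Lp) : kernel_op u \in Lfun mu p.
Proof.
apply/andP; split; rewrite inE/=; first exact/measurable_kernel_op.
apply: le_lt_trans (Lnorm_kernel_op (integrable_Lspace u) p1) _.
exact: (@Lebesgue_finite _ _ _ _ _ p1 u).
Qed.

Definition Lkernel_op (u : Lp) : Lp := Lclass (Lfun_Sub p1 (kernel_op_Lfun u)).

Lemma Lkernel_opE (u : Lp) : (Lkernel_op u : T -> R) = kernel_op u %[ae mu].
Proof. exact: LclassE. Qed.

(** Class operations are known only almost everywhere, and splitting the integral requires both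
    sections to be integrable. The identity is therefore proved off a finite union of null sets. *)
Lemma Lkernel_op_is_linear : linear Lkernel_op.
Proof.
move=> c u v; apply: LspaceP.
have [iu iv] := (integrable_Lspace u, integrable_Lspace v).
have uv : ((c *: u + v)%R : T -> R) =
    (fun x => c * (u : T -> R) x + (v : T -> R) x)%R %[ae mu].
  apply: filter_app (Lspace_scalerE c u).
  apply: filter_app (Lspace_addrE (c *: u)%R v).
  by apply: filterE => x + + _ => /(_ I) -> /= /(_ I) ->.
have Juv := kernel_op_ae _ _ uv.
apply: filter_app (Lkernel_opE (c *: u + v)%R).
apply: filter_app (Lspace_addrE (c *: Lkernel_op u)%R (Lkernel_op v)).
apply: filter_app (Lspace_scalerE c (Lkernel_op u)).
apply: filter_app (Lkernel_opE u).
apply: filter_app (Lkernel_opE v).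
apply: filter_app (ae_integrable_kernel iu).
apply: filter_app (ae_integrable_kernel iv).
apply: filterE => x ivx iux /(_ I) ev /(_ I) eu /(_ I) eZ /(_ I) eD /(_ I) e _.
rewrite e eD /= eZ /= eu ev Juv.
- rewrite /kernel_op.
  transitivity (Rintegral mu setT
    ((fun y => c * (k (x, y) * u y)) \+ (fun y => k (x, y) * v y)))%R.
    by apply: eq_Rintegral => y _ /=; rewrite mulrDr mulrCA.
  rewrite RintegralD//; last exact: (integrableZl measurableT c iux).
  by rewrite RintegralZl.
- exact: measurable_Lspace.
- apply: measurable_funD; last exact: measurable_Lspace.
  by apply: measurable_funM => //; exact: measurable_Lspace.
Qed.

HB.instance Definition _ :=
  GRing.isLinear.Build R Lp Lp *:%R Lkernel_op Lkernel_op_is_linear.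

Lemma Lkernel_op_norm (u : Lp) : (`|Lkernel_op u| <= `|u|)%R.
Proof.
rewrite -lee_fin !Lspace_normrE.
rewrite (Lnorm_ae p1 _ _ (Lkernel_opE u)); last 2 first.
- exact: measurable_Lspace.
- exact: measurable_kernel_op.
exact: Lnorm_kernel_op.
Qed.

Lemma Lkernel_op_continuous : continuous Lkernel_op.
Proof.
apply: bounded_linear_continuous; apply/linear_boundedP.
near=> r => u; apply: le_trans (Lkernel_op_norm u) _.
by rewrite ler_peMl//; near: r; exact: nbhs_pinfty_ge.
Unshelve. all: by end_near.
Qed.

Theorem schur_test : exists J : {linear Lp -> Lp},
  [/\ forall u : Lp, \forall x \ae mu,
        mu.-integrable setT (fun y => (k (x, y) * (u : T -> R) y)%:E) /\
        (J u : T -> R) x = kernel_op u x,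
      continuous J &
      forall u, (`|J u| <= `|u|)%R].
Proof.
exists Lkernel_op; split => [u| |].
- apply: filter_app (Lkernel_opE u).
  apply: filter_app (ae_integrable_kernel (integrable_Lspace u)).
  by apply: filterE => x ? /(_ I).
- exact: Lkernel_op_continuous.
- exact: Lkernel_op_norm.
Qed.

End Lspace_operator.
End schur.

(** * The exponential integral and the mass of its compositions *)

Section exponential_integral.
Local Open Scope ereal_scope.
Variable R : realType.
Local Notation mu := (@lebesgue_measure R).
Local Notation Rm := (measurableTypeR R).

(* [u `^ (-1) = u^-1] for [0 <= u] (with value [0] at [0]); [powR] is used since
   it is known to be measurable. *)
Definition E1_density (u : R) : R := (expR (- u) * u `^ (-1))%R.

(** The bounds of integration are encoded in a function of the pair (s, u), so that Tonelli can
    exchange the two integrals. *)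
Definition E1_integrand (z : Rm * Rm) : R :=
  if (0 <= z.1 <= z.2)%R then E1_density z.2 else 0%R.

(* [E1] in [\bar R], extended by [0] to negative reals; [eE1 0] is infinite, but
   [fine] maps it to the junk value [E1 0]. *)
Definition eE1 (s : R) : \bar R := \int[mu]_u (E1_integrand (s, u))%:E.

Lemma E1_density_ge0 u : (0 <= E1_density u)%R.
Proof. by rewrite mulr_ge0 ?expR_ge0 ?powR_ge0. Qed.

Lemma E1_integrand_ge0 z : (0 <= E1_integrand z)%R.
Proof. by rewrite /E1_integrand; case: ifP => // _; exact: E1_density_ge0. Qed.

Lemma measurable_E1_density : measurable_fun [set: Rm] (E1_density : Rm -> R).
Proof.
apply: measurable_funM; last exact: measurable_powR.
by apply: measurableT_comp => //; exact: measurable_expR.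
Qed.

Lemma measurable_E1_integrand : measurable_fun setT E1_integrand.
Proof.
apply: measurable_fun_ifT => //.
  apply: measurable_and.
    by apply: measurable_fun_ler => //; exact: measurable_fst.
  by apply: measurable_fun_ler; [exact: measurable_fst|exact: measurable_snd].
by apply: measurableT_comp measurable_snd; exact: measurable_E1_density.
Qed.

Lemma eE1_ge0 s : 0 <= eE1 s.
Proof. by apply: integral_ge0 => u _; rewrite lee_fin E1_integrand_ge0. Qed.

Lemma measurable_eE1 : measurable_fun [set: Rm] (eE1 : Rm -> _).
Proof.
apply: (measurable_fun_fubini_tonelli_F (fun z => (E1_integrand z)%:E)).
  by apply/measurable_EFinP; exact: measurable_E1_integrand.
by move=> z; exact: E1_integrand_ge0.
Qed.

Lemma E1E s : (0 <= s)%R -> E1 s = fine (eE1 s).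
Proof.
move=> s0; rewrite /E1 /Rintegral integral_mkcond; congr fine.
apply: eq_integral => u _; rewrite patchE /E1_integrand /= s0 /=.
have [su|su] := leP s u.
  rewrite mem_set/= ?in_itv/= ?su//.
  by rewrite /E1_density powR_inv1// (le_trans s0).
by rewrite memNset//= in_itv/= andbT; apply/negP; rewrite -ltNge.
Qed.

Lemma eE1_lt0 s : (s < 0)%R -> eE1 s = 0.
Proof.
move=> s0; apply: integral0_eq => u _.
by rewrite /E1_integrand /= leNgt s0.
Qed.

(* By Tonelli the left-hand side is [\int e^-u / u * (c * u) du], where [c * u]
   is the measure of the set of [y] with [0 <= h y <= u]. *)
Lemma integral_eE1_comp (h : Rm -> Rm) (c : R) : (0 <= c)%R ->
  measurable_fun setT h ->
  (forall u, 0 <= u -> mu [set y | 0 <= h y <= u] = (c * u)%:E)%R ->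
  \int[mu]_y eE1 (h y) <= c%:E.
Proof.
move=> c0 mh hc.
have mg : measurable_fun setT
    (fun z : Rm * Rm => (E1_integrand (h z.1, z.2))%:E).
  apply/measurable_EFinP; apply: (measurableT_comp measurable_E1_integrand).
  apply/measurable_fun_pairP; split => /=; last exact: measurable_snd.
  exact: (measurableT_comp mh measurable_fst).
rewrite (fubini_tonelli (fun z : Rm * Rm => (E1_integrand (h z.1, z.2))%:E)) /=.
(* The dominating density equals e^-u for [u >= 0] and has integral 1, which leaves the constant
   [c]. *)
- have E u : \int[mu]_y (E1_integrand (h y, u))%:E <=
      c%:E * (exponential_pdf 1 u)%:E.
    have [u0|u0] := ltP u 0%R.
      rewrite integral0_eq.
        by rewrite mule_ge0 ?lee_fin ?exponential_pdf_ge0.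
      move=> y _; rewrite /E1_integrand /=; case: ifPn => // /andP[h0 hu].
      by have := le_lt_trans (le_trans h0 hu) u0; rewrite ltxx.
    pose A := [set y | 0 <= h y <= u]%R.
    have mA : measurable A.
      rewrite -[A]setTI; apply: measurable_and => //.
        by apply: measurable_fun_ler.
      by apply: measurable_fun_ler.
    have -> : \int[mu]_y (E1_integrand (h y, u))%:E =
        \int[mu]_y ((E1_density u)%:E * (\1_A y)%:E).
      apply: eq_integral => y _; rewrite -EFinM indicE /E1_integrand /=.
      case: ifPn => hy; first by rewrite mem_set// mulr1.
      by rewrite memNset ?mulr0//; exact/negP.
    rewrite ge0_integralZl//; last 2 first.
    - by apply/measurable_EFinP; exact: measurable_indic.
    - by rewrite lee_fin E1_density_ge0.
    rewrite integral_indic// setIT [X in _ * X](hc _ u0) -!EFinM lee_fin.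
    rewrite exponential_pdfE// mul1r mulN1r mulrCA ler_wpM2l//.
    rewrite /E1_density powR_inv1//.
    (* At [u = 0] the left-hand side vanishes and the right-hand side is 1; for [u > 0] they are
       equal. *)
    have [->|un0] := eqVneq u 0%R; first by rewrite mulr0 expR_ge0.
    by rewrite -mulrA mulVf// mulr1.
  apply: le_trans.
    apply: ge0_le_integral (fun u _ => E u) => //.
    + move=> u _; apply: integral_ge0 => y _.
      by rewrite lee_fin E1_integrand_ge0.
    + apply: (measurable_fun_fubini_tonelli_G
        (fun z : Rm * Rm => (E1_integrand (h z.1, z.2))%:E)) => /=; last first.
        by move=> z; exact: E1_integrand_ge0.
      exact: mg.
    + apply/measurable_EFinP; apply: measurable_funM => //.
      exact: measurable_exponential_pdf.
  rewrite ge0_integralZl ?lee_fin//.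
  + by rewrite integral_exponential_pdf// mule1.
  + by apply/measurable_EFinP; exact: measurable_exponential_pdf.
  + by move=> u _; rewrite lee_fin exponential_pdf_ge0.
- exact: mg.
- by move=> z; exact: E1_integrand_ge0.
Qed.

End exponential_integral.

(** * Lebesgue measure concentrated on a segment *)

Section lebesgue_on.
Local Open Scope ereal_scope.
Variables (R : realType) (a b : R).
Local Notation mu := (@lebesgue_measure R).

(* Convertible to [lebesgue_on a b], which is only packaged as a measure. *)
Definition flebesgue_on : set (measurableTypeR R) -> \bar R := lebesgue_on a b.

HB.instance Definition _ := Measure.copy flebesgue_on (lebesgue_on a b).

Let flebesgue_on_fin : fin_num_fun flebesgue_on.
Proof.
apply: lty_fin_num_fun; rewrite /= /flebesgue_on /= /mrestr setTI.
rewrite lebesgue_measure_itv /=.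
by case: ifPn => _; rewrite ?ltry// -EFinB ltry.
Qed.

HB.instance Definition _ :=
  Measure_isFinite.Build _ _ _ flebesgue_on flebesgue_on_fin.

Let mab : measurable (`[a, b] : set (measurableTypeR R)).
Proof. exact: measurable_itv. Qed.

Lemma ae_lebesgue_on_itv : \forall x \ae lebesgue_on a b, `[a, b]%classic x.
Proof.
exists (~` `[a, b]); split => //; first exact: measurableC.
by rewrite /= /mrestr setICl measure0.
Qed.

(** The concentrated measure is below Lebesgue measure on every measurable set. This carries the
    marginal bounds from the whole line to [[a, b]]. *)
Lemma integral_lebesgue_on_le (f : measurableTypeR R -> \bar R) :
  measurable_fun setT f -> (forall x, 0 <= f x) ->
  \int[lebesgue_on a b]_x f x <= \int[mu]_x f x.
Proof.
move=> mf f0; apply: ge0_le_measure_integral => // S mS.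
by apply: measureIl.
Qed.

Lemma integral_lebesgue_on_itv (f : measurableTypeR R -> \bar R) :
  \int[lebesgue_on a b]_(x in `[a, b]) f x = \int[mu]_(x in `[a, b]) f x.
Proof.
apply: eq_measure_integral => A mA Aab.
by congr mu; exact: setIidl.
Qed.

Lemma integrable_lebesgue_on (f : measurableTypeR R -> \bar R) :
  (lebesgue_on a b).-integrable setT f -> mu.-integrable `[a, b] f.
Proof.
move=> fi; have /integrableP[mf fab] : (lebesgue_on a b).-integrable `[a, b] f.
  exact: integrableS fi.
by apply/integrableP; split => //; rewrite -integral_lebesgue_on_itv.
Qed.

Lemma integral_lebesgue_on (f : measurableTypeR R -> \bar R) :
  (lebesgue_on a b).-integrable setT f ->
  \int[lebesgue_on a b]_x f x = \int[mu]_(x in `[a, b]) f x.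
Proof.
move=> fi; rewrite -integral_lebesgue_on_itv.
rewrite (negligible_integral (measurableC mab) _ fi)//.
  by rewrite setTD setCK.
by rewrite /= /mrestr setICl measure0.
Qed.
End lebesgue_on.

(** * The kernel of the fractional integral and its marginals *)

Section E1_kernel.
Local Open Scope ereal_scope.
Variables (R : realType) (alpha : R).
Hypothesis alpha_gt0 : (0 < alpha)%R.
Local Notation mu := (@lebesgue_measure R).
Local Notation Rm := (measurableTypeR R).

(* Vanishes for [x < t], since [eE1] does on negative reals. *)
Definition E1_kernel (z : Rm * Rm) : R :=
  (alpha^-1 * fine (eE1 ((z.1 - z.2) / alpha)))%R.

Lemma E1_kernel_ge0 z : (0 <= E1_kernel z)%R.
Proof. by apply: mulr_ge0; [rewrite invr_ge0 ltW|exact/fine_ge0/eE1_ge0]. Qed.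

Lemma measurable_E1_kernel : measurable_fun setT E1_kernel.
Proof.
apply: measurable_funM => //; apply: measurableT_comp => //.
apply: (measurableT_comp (@measurable_eE1 R)).
apply: measurable_funM => //.
by apply: measurable_funB; [exact: measurable_fst|exact: measurable_snd].
Qed.

Lemma E1_kernelE x t : (t <= x)%R ->
  E1_kernel (x, t) = (alpha^-1 * E1 ((x - t) / alpha))%R.
Proof. by move=> tx; rewrite /E1_kernel /= E1E// divr_ge0 ?subr_ge0// ltW. Qed.

Lemma E1_kernel_eq0 x t : (x < t)%R -> E1_kernel (x, t) = 0%R.
Proof.
move=> xt; rewrite /E1_kernel /= eE1_lt0 ?mulr0//.
by rewrite ltr_pdivrMr// mul0r subr_lt0.
Qed.

(** Treats both marginals at once: [h] is a section with either coordinate fixed. Rescaling the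
    argument by [alpha] multiplies the mass by [alpha], which cancels the factor [alpha^-1] of the
    kernel. *)
Lemma integral_E1_kernel_le1 (h : Rm -> Rm * Rm) : measurable_fun setT h ->
  (forall u, 0 <= u ->
    mu [set y | 0 <= ((h y).1 - (h y).2) / alpha <= u] = (alpha * u)%:E)%R ->
  \int[mu]_y (E1_kernel (h y))%:E <= 1.
Proof.
move=> mh hu.
have md : measurable_fun [set: Rm]
    ((fun y => ((h y).1 - (h y).2) / alpha)%R : Rm -> Rm).
  apply: measurable_funM => //; apply: measurable_funB.
    exact: (measurableT_comp measurable_fst mh).
  exact: (measurableT_comp measurable_snd mh).
have mE := measurableT_comp (@measurable_eE1 R) md.
have := integral_eE1_comp (ltW alpha_gt0) md hu.
rewrite -(@lee_pmul2l _ alpha^-1%:E) ?lte_fin ?invr_gt0//.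
rewrite -EFinM mulVf ?gt_eqF//; apply: le_trans.
rewrite -ge0_integralZl//; last 2 first.
- by move=> y _; exact: eE1_ge0.
- by rewrite lee_fin invr_ge0 ltW.
apply: ge0_le_integral => //.
- by move=> y _; rewrite lee_fin E1_kernel_ge0.
- by apply/measurable_EFinP; exact: (measurableT_comp measurable_E1_kernel mh).
- by apply: emeasurable_funM.
move=> y _; rewrite EFinM; apply: lee_wpmul2l.
  by rewrite lee_fin invr_ge0 ltW.
(* On nonnegative extended reals [fine] can only decrease the value, since it sends [+oo] to 0. *)
have := @eE1_ge0 R (((h y).1 - (h y).2) / alpha)%R.
by case: (eE1 _) => [r _|_|]; rewrite ?leey ?lexx.
Qed.

Let mu_segment (x y c : R) : (0 <= c)%R -> (y = x + c)%R ->
  mu (`[x, y] : set Rm) = c%:E.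
Proof.
move=> c0 ->; rewrite lebesgue_measure_itv /= lte_fin ltrDl.
rewrite lt_neqAle c0 andbT eq_sym; case: eqVneq => /= [->//|_].
by rewrite EFinD addeAC -EFinB subrr add0e.
Qed.

Let E1_arg x t u :
  (0 <= (x - t) / alpha <= u = (t <= x) && (x - t <= alpha * u))%R.
Proof.
by rewrite ler_pdivlMr// mul0r subr_ge0 ler_pdivrMr// (mulrC u).
Qed.

Lemma integral_E1_kernel_snd x : \int[mu]_t (E1_kernel (x, t))%:E <= 1.
Proof.
apply: (@integral_E1_kernel_le1 (fun t => (x, t))) => [|u u0].
  exact: pair1_measurable.
rewrite (_ : mkset _ = `[(x - alpha * u)%R, x]%classic); last first.
  apply/seteqP; split => t /=;
  by rewrite in_itv/= E1_arg andbC lerBlDr -lerBlDl.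
by apply: mu_segment; rewrite ?subrK ?mulr_ge0// ltW.
Qed.

Lemma integral_E1_kernel_fst t : \int[mu]_x (E1_kernel (x, t))%:E <= 1.
Proof.
apply: (@integral_E1_kernel_le1 (fun x => (x, t))) => [|u u0].
  exact: pair2_measurable.
rewrite (_ : mkset _ = `[t, (t + alpha * u)%R]%classic); last first.
  by apply/seteqP; split => x /=; rewrite in_itv/= E1_arg lerBlDl.
by apply: mu_segment; rewrite ?mulr_ge0// ltW.
Qed.
End E1_kernel.

(** * The fractional integral as an instance of Schur's test *)

Unset Implicit Arguments.

Theorem theorem2p1 (R : realType) (alpha a b : R) (p : \bar R)
    (alpha_gt0 : 0 < alpha) (p1 : (1 <= p)%E) (ltab : a < b) :
  exists J : {linear LspaceType (lebesgue_on a b) p1 ->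
                     LspaceType (lebesgue_on a b) p1},
    [/\ forall f : LspaceType (lebesgue_on a b) p1,
          is_frac_integral alpha a b f (J f),
        continuous J &
        forall f : LspaceType (lebesgue_on a b) p1, `|J f| <= `|f|].
Proof.
have K0 := E1_kernel_ge0 alpha_gt0.
have mK := @measurable_E1_kernel R alpha.
have [|| J [JE Jc J1]] :=
    @schur_test _ _ _ (flebesgue_on a b) _ mK K0 _ _ _ p1.
- move=> x; apply: le_trans (integral_E1_kernel_snd alpha_gt0 x).
  apply: integral_lebesgue_on_le; last by move=> t; rewrite lee_fin K0.
  exact/measurable_EFinP/(measurableT_comp mK)/pair1_measurable.
- move=> t; apply: le_trans (integral_E1_kernel_fst alpha_gt0 t).
  apply: integral_lebesgue_on_le; last by move=> x; rewrite lee_fin K0.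
  exact/measurable_EFinP/(measurableT_comp mK)/pair2_measurable.
exists J; split => //= f; rewrite /is_frac_integral.
(* [JE f] is stated for [flebesgue_on]; convertibility allows restating it for [lebesgue_on]. *)
have JEf : \forall x \ae lebesgue_on a b, _ := JE f.
have aeF := ae_filter_ringOfSetsType (lebesgue_on a b).
apply: (filterS2 _ _ (ae_lebesgue_on_itv a b) JEf) => x + [Ki JfE].
rewrite /= in_itv/= => /andP[ax xb].
have subx : `[a, x] `<=` `[a, b] by apply: subset_itvl; rewrite bnd_simp.
have hE t : t \in `[a, x]%classic ->
    E1_kernel alpha (x, t) * (f : R -> R) t =
    alpha^-1 * frac_integrand alpha f x t.
  by rewrite inE/= in_itv/= => /andP[_ tx]; rewrite E1_kernelE// mulrA.
have hi : lebesgue_measure.-integrable `[a, x]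
    (fun t => (E1_kernel alpha (x, t) * (f : R -> R) t)%:E).
  by apply: integrableS (integrable_lebesgue_on Ki).
have fi : lebesgue_measure.-integrable `[a, x]
    (EFin \o frac_integrand alpha f x).
  (* Multiplying by [alpha] removes the normalisation [alpha^-1] of the kernel. *)
  apply: (eq_integrable _ _ _ _ (integrableZl _ alpha hi)) => // t tax.
  by rewrite -EFinM hE// mulrA mulfV ?gt_eqF// mul1r.
split => //; rewrite JfE -RintegralZl//; congr fine.
(* The integrals run over [[a, b]] and [[a, x]]. Extended by zero to the line, their integrands
   could differ only for [x < t <= b], where the kernel vanishes. *)
rewrite (integral_lebesgue_on Ki) [LHS]integral_mkcond [RHS]integral_mkcond.
apply: eq_integral => t _; rewrite !patchE.
case: ifPn => tab; case: ifPn => tax //; first by rewrite hE.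
- rewrite E1_kernel_eq0 ?mul0r// ltNge; apply: contra tax => tx.
  by move: tab; rewrite !inE/= !in_itv/= => /andP[-> _].
- by move: tab; rewrite notin_setE => -[]; apply: subx; move: tax; rewrite inE.
Qed.
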